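(* Let $G$ be a graph with $n$ vertices and assume $\mathrm{Pin}(G,k) \ne \emptyset$. Then the poset $\mathcal{P}(G,k)$ is a join semilattice. For any two pinnacle sets $P, Q \in \mathrm{Pin}(G,k)$ with $P = \{p_1, p_2, \ldots, p_k\}$ and $Q = \{q_1, q_2, \ldots, q_k\}$ (elements listed in increasing order), their join is $P \lor Q = \{\max\{p_i, q_i\} : i = 1, 2, \ldots, k\}$.
   Context: Graphs are finite and simple, and $[n] = \{1,2,\ldots,n\}$. A labeling of a graph $G$ with $n$ vertices is a bijection $\lambda : V(G) \to [n]$. The label $\lambda(u)$ of a vertex $u$ is a pinnacle of $(G,\lambda)$ if $\lambda(u) > \lambda(v)$ for every neighbor $v$ of $u$ (so the label of an isolated vertex is vacuously a pinnacle). The pinnacle set of $(G,\lambda)$ is the set of all pinnacles of $(G,\lambda)$. A subset $S \subseteq [n]$ is a pinnacle set of $G$ if there is a labeling $\lambda$ of $G$ such that $S$ is the pinnacle set of $(G,\lambda)$. $\mathrm{Pin}(G,k)$ denotes the collection of all size-$k$ pinnacle sets of $G$. For $P = \{p_1 < p_2 < \cdots < p_k\}$ and $Q = \{q_1 < q_2 < \cdots < q_k\}$ in $\mathrm{Pin}(G,k)$, define $P \preceq Q$ if and only if $p_i \le q_i$ for $i = 1, \ldots, k$. Then $\mathcal{P}(G,k) = (\mathrm{Pin}(G,k), \preceq)$ is a partial order. A poset is a join semilattice if any two of its elements have a least upper bound (join). *)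

(* Defs.v *)
From HB Require Import structures.
From mathcomp Require Import all_boot all_order.

Set Implicit Arguments.
Unset Strict Implicit.
Unset Printing Implicit Defensive.

Import Order.TTheory.
Local Open Scope order_scope.

Record sgraph := SGraph {
  vertex :> finType;
  adj : rel vertex;
  adj_sym : symmetric adj;
  adj_irrefl : irreflexive adj }.

(* With n = #|G|, labels live in 'I_n.+1 = {0, ..., n}, and [n] is the subset
   of nonzero elements, so that a label has its true value. *)
Definition label (G : sgraph) := 'I_(#|G|).+1.

Definition labels (G : sgraph) : {set label G} := [set m : label G | (0 < m)%N].

Section Pinnacles.
Variable G : sgraph.
Implicit Types (l : {ffun G -> label G}) (S : {set label G}).

Definition is_labeling l : bool :=
  injectiveb l && ([set l u | u : G] == labels G).

Definition has_pinnacle_at l (u : G) : bool :=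
  [forall v, adj u v ==> (l v < l u)].

Definition pinnacles l : {set label G} := [set l u | u : G & has_pinnacle_at l u].

Definition is_pinnacle_set S : bool :=
  (S \subset labels G) && [exists l, is_labeling l && (pinnacles l == S)].

Definition Pin (k : nat) : {set {set label G}} :=
  [set S | is_pinnacle_set S & #|S| == k].

(* The i-th smallest element of S, counted from 0; ord0 is only a default for
   i out of range. *)
Definition elt S (i : nat) : label G := nth ord0 (sort <=%O (enum S)) i.

End Pinnacles.

Record pin_poset (G : sgraph) (k : nat) := PinPoset {
  pin_set :> {set label G};
  pin_setP : pin_set \in Pin G k }.

HB.instance Definition _ G k := [isSub for @pin_set G k].
HB.instance Definition _ G k := [Finite of pin_poset G k by <:].

Section PinOrder.
Variables (G : sgraph) (k : nat).
Implicit Types P Q R : pin_poset G k.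

Definition pin_le P Q : bool := [forall i : 'I_k, elt P i <= elt Q i].

Lemma pin_le_refl : reflexive pin_le.
Proof. by move=> P; apply/forallP => i. Qed.

Lemma pin_le_trans : transitive pin_le.
Proof.
move=> Q P R /forallP PQ /forallP QR; apply/forallP => i.
exact: le_trans (PQ i) (QR i).
Qed.

Lemma size_sort_pin P : size (sort <=%O (enum P)) = k.
Proof.
by rewrite size_sort -cardE; have := pin_setP P; rewrite inE => /andP[_ /eqP].
Qed.

Lemma pin_le_anti : antisymmetric pin_le.
Proof.
move=> P Q /andP[/forallP PQ /forallP QP].
suff eqPQ : sort <=%O (enum P) = sort <=%O (enum Q).
  apply/val_inj/setP => x /=.
  by rewrite -(mem_enum P) -(mem_enum Q) -(mem_sort <=%O) eqPQ mem_sort.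
apply: (@eq_from_nth _ ord0); first by rewrite !size_sort_pin.
move=> i; rewrite size_sort_pin => ik.
by apply: le_anti; rewrite (PQ (Ordinal ik)) (QP (Ordinal ik)).
Qed.

Fact pin_display : Order.disp_t. Proof. exact: Order.Disp tt tt. Qed.

HB.instance Definition _ :=
  Order.Le_isPOrder.Build pin_display (pin_poset G k)
    pin_le_refl pin_le_anti pin_le_trans.

End PinOrder.

Definition is_join d (L : porderType d) (x y z : L) : Prop :=
  [/\ x <= z, y <= z & forall w : L, x <= w -> y <= w -> z <= w].

(* Order.joinSemilatticeType bundles a join operation; this is the property
   that a given partial order admits one. *)
Definition join_semilattice d (L : porderType d) : Prop :=
  forall x y : L, exists z : L, is_join x y z.

(* Main.v *)
Require Import Defs.
From mathcomp Require Import all_boot all_order.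

(** Pinnacle sets of a fixed size k are closed upwards: if P is a pinnacle set
    and Q is a k-subset of [n] whose i-th smallest element is at least that of
    P for every i, then Q is a pinnacle set as well ([Pin_up]).  The entrywise
    maximum of two pinnacle sets lies above each of them, so it is a pinnacle
    set; its sorted list of elements is the list of entrywise maxima, so it is
    the least upper bound.

    For the upward closure, take a labeling with pinnacle set P and relabel
    without moving the pinnacle vertices: the label set P is sent onto Q in
    increasing order, and the complement of P onto the complement of Q in
    increasing order.  Labels in P go up and hence, by counting, labels outside
    P go down ([exists_raising_bijection]).  Two pinnacle vertices are never
    adjacent, so an edge joins either two non-pinnacle vertices, whose relative
    order is kept, or a pinnacle vertex to a lower non-pinnacle vertex, and
    that gap can only widen ([pinnacles_relabel]).  The same vertices therefore
    carry the pinnacles of the new labeling. *)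

Set Implicit Arguments.
Unset Strict Implicit.
Unset Printing Implicit Defensive.

Import Order.TTheory.
Local Open Scope order_scope.

(** * Raising a subset of a finite total order *)

Section IncreasingTransfer.
Context {d : Order.disp_t} {T : finOrderType d}.
Implicit Types (A B : {set T}) (x y t : T).

Definition below t : {set T} := [set x | x <= t].

Lemma mem_order_enum A x : (x \in Order.enum A) = (x \in A).
Proof. by rewrite mem_sort mem_enum. Qed.

Lemma size_order_enum A : size (Order.enum A) = #|A|.
Proof. by rewrite size_sort -cardE. Qed.

Lemma order_enum_lt_sorted A : sorted <%O (Order.enum A).
Proof. by rewrite sort_lt_sorted enum_uniq. Qed.

Lemma index_order_enum A x : x \in A -> (index x (Order.enum A) < #|A|)%N.
Proof. by rewrite -mem_order_enum -index_mem size_order_enum. Qed.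

(** Trades positions in a sorted list for counts.  Comparing sets by counts is
    what makes passing to complements immediate. *)
Lemma nth_order_enum_le x0 A (i : nat) t : (i < #|A|)%N ->
  (nth x0 (Order.enum A) i <= t) = (i < #|A :&: below t|)%N.
Proof.
have -> : #|A :&: below t| = count (<= t) (Order.enum A).
  rewrite -size_filter cardE; apply/perm_size/uniq_perm; rewrite ?enum_uniq //.
    by rewrite filter_uniq // sort_uniq enum_uniq.
  by move=> x; rewrite mem_enum !inE mem_filter mem_order_enum andbC.
move=> iA; case: ltnP => ic; first by rewrite nth_count_le // sort_le_sorted.
apply/negbTE; rewrite -ltNge; apply: nth_count_gt; first exact: sort_le_sorted.
by rewrite ic size_order_enum.
Qed.

(** For sets of equal size this is the entrywise order of the sorted lists,
    with A below B. *)
Definition dominates A B :=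
  forall t, (#|B :&: below t| <= #|A :&: below t|)%N.

Lemma dominates_nth x0 A B : #|A| = #|B| ->
  (forall i, (i < #|A|)%N ->
     nth x0 (Order.enum A) i <= nth x0 (Order.enum B) i) ->
  dominates A B.
Proof.
move=> eqAB leAB t; rewrite leqNgt; apply/negP => ltAB.
have iB : (#|A :&: below t| < #|B|)%N.
  by apply: leq_trans ltAB _; apply/subset_leq_card/subsetIl.
have iA := iB; rewrite -eqAB in iA.
have := leAB _ iA; rewrite leNgt => /negP; apply.
apply: (@le_lt_trans _ _ t); first by rewrite nth_order_enum_le.
by rewrite ltNge nth_order_enum_le // ltnn.
Qed.

(** The counts below t of a set and of its complement have a fixed sum, so
    raising a set lowers its complement. *)
Lemma dominates_setC A B : dominates A B -> dominates (~: B) (~: A).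
Proof.
move=> domAB t.
have split C : (#|C :&: below t| + #|~: C :&: below t|)%N = #|below t|.
  by rewrite setIC [~: C :&: _]setIC -setDE cardsID.
by rewrite -(leq_add2l #|B :&: below t|) split -(split A) leq_add2r.
Qed.

(** On A, when A and B have the same size, this is the increasing bijection
    from A to B; x itself only serves as the default of [nth]. *)
Definition transfer A B x : T := nth x (Order.enum B) (index x (Order.enum A)).

Section Transfer.
Variables (A B : {set T}) (eqAB : #|A| = #|B|).

Lemma transfer_mem x : x \in A -> transfer A B x \in B.
Proof.
move=> /index_order_enum ix.
by rewrite -mem_order_enum mem_nth // size_order_enum -eqAB.
Qed.

Lemma transfer_mono : {in A &, {mono transfer A B : x y / x < y}}.
Proof.
move=> x y xA yA; have [ix iy] := (index_order_enum xA, index_order_enum yA).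
rewrite /transfer [in RHS](_ : (x < y) =
  (nth x (Order.enum A) (index x (Order.enum A))
     < nth x (Order.enum A) (index y (Order.enum A)))).
  rewrite (set_nth_default x y) ?size_order_enum -?eqAB //.
  by rewrite !(lt_sorted_ltn_nth _ (order_enum_lt_sorted _)) ?inE
             ?size_order_enum -?eqAB.
by rewrite !nth_index ?mem_order_enum.
Qed.

Lemma transfer_ge x : dominates A B -> x \in A -> x <= transfer A B x.
Proof.
move=> domAB xA; have ix := index_order_enum xA.
rewrite -[leLHS](nth_index x (s := Order.enum A)) ?mem_order_enum //.
rewrite nth_order_enum_le //; apply: leq_trans (domAB _).
by rewrite -(nth_order_enum_le x) -?eqAB.
Qed.

Lemma transfer_le x : dominates B A -> x \in A -> transfer A B x <= x.
Proof.
move=> domBA xA; have ix := index_order_enum xA.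
rewrite nth_order_enum_le -?eqAB //; apply: leq_trans (domBA _).
by rewrite -(nth_order_enum_le x) // nth_index ?mem_order_enum.
Qed.

End Transfer.

(** Glue the increasing bijection from A to B with the one between the
    complements: the first one raises, the second one lowers. *)
Lemma exists_raising_bijection A B : #|A| = #|B| -> dominates A B ->
  exists f : T -> T, [/\ injective f,
    f @: A = B,
    {in A, forall x, x <= f x},
    {in ~: A, forall x, f x <= x} &
    {in ~: A &, {mono f : x y / x < y}}].
Proof.
move=> eqAB domAB.
have eqC : #|~: A| = #|~: B| by rewrite [LHS]cardsCs [RHS]cardsCs !setCK eqAB.
have domC := dominates_setC domAB.
pose f x := if x \in A then transfer A B x else transfer (~: A) (~: B) x.
have fA : {in A, f =1 transfer A B} by rewrite /f => x ->.
have fC : {in ~: A, f =1 transfer (~: A) (~: B)}.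
  by rewrite /f => x; rewrite inE => /negbTE ->.
have monoC : {in ~: A &, {mono f : x y / x < y}}.
  by move=> x y xA yA; rewrite !fC // transfer_mono.
have memf x : (f x \in B) = (x \in A).
  have [xA | xA] := boolP (x \in A); first by rewrite fA // transfer_mem.
  have xC : x \in ~: A by rewrite inE.
  by apply/negbTE; rewrite -in_setC fC // transfer_mem.
have injf : injective f.
  move=> x y eqf; have mxy : (x \in A) = (y \in A) by rewrite -!memf eqf.
  have nlt u v : (u \in A) = (v \in A) -> f u = f v -> ~~ (u < v).
    move=> muv fuv; have [uA | uA] := boolP (u \in A).
      have vA : v \in A by rewrite -muv.
      by rewrite -(transfer_mono eqAB) // -!fA // fuv ltxx.
    have uC : u \in ~: A by rewrite inE.
    have vC : v \in ~: A by rewrite inE -muv.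
    by rewrite -(monoC _ _ uC vC) fuv ltxx.
  by apply/le_anti; rewrite !leNgt !nlt.
exists f; split=> // [|x xA|x xA].
- apply/eqP; rewrite eqEcard card_imset // -eqAB leqnn andbT.
  by apply/subsetP => _ /imsetP[x xA ->]; rewrite memf.
- by rewrite fA // transfer_ge.
- by rewrite fC // transfer_le.
Qed.

End IncreasingTransfer.

(** * Pinnacle sets under relabeling *)

Section Relabeling.
Variable G : sgraph.
Implicit Types (l : {ffun G -> label G}) (S P Q : {set label G}).

Lemma mem_pinnacles l (u : G) : injective l ->
  (l u \in pinnacles l) = has_pinnacle_at l u.
Proof.
move=> injl; apply/imsetP/idP => [[v pv /injl ->]|pu].
  by rewrite inE in pv.
by exists u; rewrite ?inE.
Qed.

(** The relabeled pinnacles sit at the same vertices.  A neighbor of a pinnacle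
    vertex is not a pinnacle, so its label does not rise while the pinnacle
    does not sink.  A non-pinnacle vertex keeps its larger neighbor: the order
    within the non-pinnacles is kept, and a pinnacle neighbor stays above. *)
Lemma pinnacles_relabel l (f : label G -> label G) :
  injective l ->
  {in pinnacles l, forall x, x <= f x} ->
  {in ~: pinnacles l, forall x, f x <= x} ->
  {in ~: pinnacles l &, {mono f : x y / x < y}} ->
  pinnacles [ffun u => f (l u)] = f @: pinnacles l.
Proof.
move=> injl f_ge f_le f_mono.
have same u : has_pinnacle_at [ffun u => f (l u)] u = has_pinnacle_at l u.
  have [pu | npu] := boolP (has_pinnacle_at l u).
    apply/forallP => v; apply/implyP => uv; rewrite !ffunE.
    have ltvu : l v < l u by have /forallP/(_ v) := pu; rewrite uv.
    have npv : l v \in ~: pinnacles l.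
      rewrite inE mem_pinnacles //; apply/negP => /forallP/(_ u).
      by rewrite adj_sym uv ltNge (ltW ltvu).
    apply: le_lt_trans (f_le _ npv) _; apply: lt_le_trans ltvu _.
    by apply: f_ge; rewrite mem_pinnacles.
  apply/negbTE; move: (npu); rewrite !negb_forall => /existsP[v].
  rewrite negb_imply => /andP[uv]; rewrite -leNgt le_eqVlt => /orP[|ltuv].
    by move=> /eqP/injl uveq; rewrite uveq adj_irrefl in uv.
  have nlu : l u \in ~: pinnacles l by rewrite inE mem_pinnacles.
  apply/existsP; exists v; rewrite uv !ffunE /= -leNgt.
  have [pv | npv] := boolP (l v \in pinnacles l).
    by apply: le_trans (f_le _ nlu) _; apply: le_trans (ltW ltuv) (f_ge _ pv).
  by rewrite ltW // f_mono // inE.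
apply/setP => y; apply/imsetP/imsetP => [[u pu ->] | [_ /imsetP[u pu ->] ->]].
  by exists (l u); rewrite ?ffunE // imset_f // inE -same; rewrite inE in pu.
by exists u; rewrite ?ffunE // inE same; rewrite inE in pu.
Qed.

(** The assumption on elements makes the raising bijection from P to Q
    available, and composing a labeling with it yields Q. *)
Lemma Pin_up k P Q :
  P \in Pin G k -> Q \subset labels G -> #|Q| = k ->
  (forall i : 'I_k, elt P i <= elt Q i) -> Q \in Pin G k.
Proof.
rewrite !inE => /andP[/andP[sP /existsP[l /andP[/andP[/injectiveP injl]]]]].
move=> /eqP iml /eqP pinl /eqP cP sQ cQ leP.
have eqPQ : #|P| = #|Q| by rewrite cQ.
have domPQ : dominates P Q.
  apply: (@dominates_nth _ _ ord0) => // i; rewrite cP => ik.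
  exact: (leP (Ordinal ik)).
have [f [injf imf f_ge f_le f_mono]] := exists_raising_bijection eqPQ domPQ.
rewrite /is_pinnacle_set sQ cQ eqxx andbT.
apply/existsP; exists [ffun u => f (l u)].
rewrite pinnacles_relabel ?pinl // imf eqxx andbT /is_labeling.
have injfl : injective [ffun u => f (l u)].
  by move=> u v; rewrite !ffunE => /injf/injl.
apply/andP; split; first exact/injectiveP.
rewrite eqEcard card_imset // -iml card_imset // leqnn andbT iml.
apply/subsetP => _ /imsetP[u _ ->]; rewrite ffunE inE lt0n.
(* Labels start at 1, so 0 is outside P; it can only go down, hence is fixed,
   and no other label is sent to it. *)
have f0 : f ord0 = ord0.
  apply/le_anti/andP; split; last exact: leq0n.
  by apply: f_le; rewrite inE; apply/negP => /(subsetP sP); rewrite inE.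
apply/negP => /eqP fl0; have /injf lu0 : f (l u) = f ord0.
  by rewrite f0; apply: val_inj.
have : l u \in labels G by rewrite -iml imset_f.
by rewrite lu0 inE.
Qed.

Definition entrywise_max k P Q : {set label G} :=
  [set Order.max (elt P i) (elt Q i) | i : 'I_k].

(** Two strictly increasing sequences have a strictly increasing entrywise
    maximum, so the maxima are distinct and already listed in order. *)
Lemma order_enum_entrywise_max k P Q : #|P| = k -> #|Q| = k ->
  Order.enum (entrywise_max k P Q) =
    mkseq (fun i => Order.max (elt P i) (elt Q i)) k.
Proof.
move=> cP cQ; set s := mkseq _ k.
have elt_lt S : #|S| = k -> {in [pred i | (i < k)%N] &,
    {homo elt S : i j / (i < j)%N >-> i < j}}.
  move=> cS i j ik jk ij; rewrite /elt.
  by rewrite (lt_sorted_ltn_nth _ (order_enum_lt_sorted _)) // inE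
             size_order_enum cS.
have ss : sorted <%O s.
  apply: (path.homo_sorted_in (e := ltn) (P := [pred i | (i < k)%N]));
    last exact: iota_ltn_sorted.
    move=> i j ik jk ij; rewrite gt_max !lt_max.
    by rewrite (elt_lt P cP i j) // (elt_lt Q cQ i j) // orbT.
  by apply/allP => i; rewrite mem_iota.
apply: lt_sorted_eq => //; first exact: order_enum_lt_sorted.
move=> x; rewrite mem_order_enum; apply/imsetP/mapP => [[i _ ->]|[i]].
  by exists (val i); rewrite // mem_iota /=.
by rewrite mem_iota /= => ik ->; exists (Ordinal ik).
Qed.

End Relabeling.

Theorem theorem5p2 (G : sgraph) (k : nat) (hne : Pin G k != set0) :
  join_semilattice (pin_poset G k) /\
  forall P Q R : pin_poset G k, is_join P Q R ->
    pin_set R = [set Order.max (elt P i) (elt Q i) | i : 'I_k].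
Proof.
have cardP (P : pin_poset G k) : #|P| = k.
  by have := pin_setP P; rewrite inE => /andP[_ /eqP].
have subP (P : pin_poset G k) : P \subset labels G.
  by have := pin_setP P; rewrite inE => /andP[/andP[]].
have elt_label (P : pin_poset G k) (i : 'I_k) : elt P i \in labels G.
  apply: (subsetP (subP P)).
  by rewrite -mem_order_enum mem_nth ?size_order_enum ?cardP.
have elt_max (P Q : pin_poset G k) (i : 'I_k) :
    elt (entrywise_max k P Q) i = Order.max (elt P i) (elt Q i).
  by rewrite {1}/elt order_enum_entrywise_max // nth_mkseq.
have max_pin (P Q : pin_poset G k) : entrywise_max k P Q \in Pin G k.
  apply: (@Pin_up _ k P) => [|||i]; first exact: pin_setP.
  - apply/subsetP => _ /imsetP[i _ ->]; case: leP => _; exact: elt_label.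
  - by rewrite -size_order_enum order_enum_entrywise_max // size_mkseq.
  - by rewrite elt_max le_max lexx.
pose J P Q := PinPoset (max_pin P Q).
have J_join P Q : is_join P Q (J P Q).
  split=> [||R /forallP PR /forallP QR]; apply/forallP => i; rewrite elt_max.
  - by rewrite le_max lexx.
  - by rewrite le_max lexx orbT.
  - by rewrite ge_max PR QR.
split=> [P Q|P Q R [PR QR minR]]; first by exists (J P Q).
have [PJ QJ minJ] := J_join P Q.
by rewrite (_ : R = J P Q) //; apply/le_anti; rewrite minR // minJ.
Qed.
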